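(* Let $G=(V,E)$ be a finite connected undirected simple graph with $V=\{1,\dots,N\}$. Let $\{\xi_i\}_{i\in V}$ be nonzero complex numbers with $\xi_i+\xi_i^{-1}\neq 0$ for all $i$, and let $\{\beta_{ij}\}_{ij\in E}$ be complex numbers (equivalently, treat all of them as free variables and read the identity as an identity of rational functions). Then \[ \sum_{x_1,\ldots,x_N=\pm 1}\ \prod_{ij \in E}\bigl(1+x_{i}x_{j}\beta_{ij}\xi_{i}^{-x_i}\xi_{j}^{-x_j}\bigr)\prod_{i \in V}\frac{\xi_{i}^{x_i}}{\xi_{i}+\xi_{i}^{-1}} =\sum_{s \subset E}\ \prod_{ij \in s} \beta_{ij}\prod_{i \in V} f_{d_i(s)}(\xi_{i}-\xi_{i}^{-1}), \] where the sum on the right runs over all subsets $s$ of $E$ (including $s=\emptyset$) and $d_i(s)$ is the number of edges of $s$ incident to $i$.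
   Context: The polynomials $f_n(x)$, $n\ge 0$, are defined by $f_0(x)=1$, $f_1(x)=0$ and $f_{n+1}(x)=x f_n(x)+f_{n-1}(x)$ for $n\ge 1$. Edges $ij\in E$ are unordered pairs of distinct nodes. *)

(* Defs.v *)
From mathcomp Require Import all_boot all_order all_algebra.
From mathcomp Require Import reals complex.

Set Implicit Arguments.
Unset Strict Implicit.
Unset Printing Implicit Defensive.

Import GRing.Theory.
Local Open Scope ring_scope.

Fixpoint fpoly (K : nzRingType) (n : nat) : {poly K} :=
  match n with
  | 0 => 1
  | S m => match m with
           | 0 => 0
           | S k => 'X * fpoly K m + fpoly K k
           end
  end.

(* A graph on T is given by its set of edges, each edge being the two-element
   set of its endpoints; this excludes loops and multiple edges. *)
Definition simple_graph (T : finType) (E : {set {set T}}) : Prop :=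
  forall e : {set T}, e \in E -> #|e| = 2%N.

Definition adjacent (T : finType) (E : {set {set T}}) : rel T :=
  fun i j => [set i; j] \in E.

Definition connected_graph (T : finType) (E : {set {set T}}) : Prop :=
  forall i j : T, connect (adjacent E) i j.

Definition degree_in (T : finType) (s : {set {set T}}) (i : T) : nat :=
  #|[set e in s | i \in e]|.

(* A spin configuration is a boolean function: true is +1 and false is -1. *)
Definition spin (b : bool) : int := if b then 1 else -1.

(* Main.v *)
Require Import Defs.
From mathcomp Require Import all_boot all_order all_algebra.
From mathcomp Require Import reals complex ring.

Import GRing.Theory.
Local Open Scope ring_scope.

(** Expanding the product over edges and summing over the spins vertex by
    vertex reduces the identity to a statement about a single vertex.  Inserting
    a minus sign at both endpoints of an edge does not change the edge factor, so
    a spin [x] may be taken to contribute [- x xi^(-x)], i.e. [- xi^-1] or [xi].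
    These are the two roots of [t^2 = (xi - xi^-1) t + 1], so the weighted vertex
    sum of [t^n] satisfies the recurrence defining [f_n]. *)

Lemma prod_1D_subsets (K : comPzRingType) (I : finType) (A : {set I})
    (F : I -> K) :
  \prod_(i in A) (1 + F i) =
  \sum_(s : {set I} | s \subset A) \prod_(i in s) F i.
Proof.
(* Indices outside [A] get the factor [0 + 1], so in the full expansion every subset not contained
   in [A] picks up a zero. *)
transitivity (\prod_i ((if i \in A then F i else 0) + 1)).
  rewrite [LHS]big_mkcond; apply: eq_bigr => i _.
  by case: ifP => _; rewrite ?add0r // addrC.
rewrite bigA_distr [RHS]big_mkcond; apply: eq_bigr => s _.
have [sA|/subsetPn[i is_ iA]] := boolP (s \subset A).
  rewrite [RHS]big_mkcond; apply: eq_bigr => i _.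
  by case: ifP => // /(subsetP sA) ->.
by rewrite (bigD1 i) //= is_ (negPf iA) mul0r.
Qed.

(** An edge has two distinct endpoints, so exactly one of its two orderings is increasing: grouping
    pairs by the edge they span leaves one pair per edge. *)
Lemma prod_edges_ord (K : comPzRingType) (N : nat) (E : {set {set 'I_N}})
    (F : {set 'I_N} -> K) :
  simple_graph E ->
  \prod_(i < N) \prod_(j < N | (i < j)%N && ([set i; j] \in E)) F [set i; j] =
  \prod_(e in E) F e.
Proof.
move=> E_simple; rewrite pair_big_dep /=.
rewrite (partition_big (fun p => [set p.1; p.2]) (mem E)) /=; last first.
  by move=> p /andP[].
apply: eq_bigr => e eE.
have /eqP/cards2P[a [b [neq_ab def_e]]] := E_simple e eE.
wlog lt_ab : a b neq_ab def_e / (a < b)%N.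
  move=> IH; case: (ltngtP a b) => [| |/val_inj ab]; first exact: IH.
    by apply: IH; rewrite 1?eq_sym // def_e setUC.
  by rewrite ab eqxx in neq_ab.
rewrite (big_pred1 (a, b)) /= -?def_e // => -[i j] /=.
apply/idP/eqP => [/andP[/andP[lt_ij _] /eqP ij_e]|[-> ->]]; last first.
  by rewrite lt_ab -def_e eE eqxx.
have := set21 i j; have := set22 i j; rewrite ij_e def_e.
move=> /set2P[] ej /set2P[] ei //; rewrite ei ej ?ltnn // in lt_ij *.
by rewrite ltnNge ltnW in lt_ij.
Qed.

Lemma prod_incident_degree (K : comPzRingType) (T : finType)
    (s : {set {set T}}) (u : T -> K) :
  \prod_(e in s) \prod_(i in e) u i = \prod_i u i ^+ degree_in s i.
Proof.
rewrite (exchange_big_dep predT) //=; apply: eq_bigr => i _.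
rewrite -prodr_const; apply: eq_bigl => e; by rewrite inE.
Qed.

(** For fixed [s] the summand is a product of functions of single spins, so the sum over
    configurations factors into one sum per vertex. *)
Lemma sum_spins_edge_expansion (K : comPzRingType) (T B : finType)
    (E : {set {set T}}) (beta : {set T} -> K) (t w : T -> B -> K) :
  \sum_(x : {ffun T -> B})
     (\prod_(e in E) (1 + beta e * \prod_(i in e) t i (x i))
      * \prod_i w i (x i)) =
  \sum_(s : {set {set T}} | s \subset E)
     ((\prod_(e in s) beta e)
      * \prod_i \sum_(b : B) t i b ^+ degree_in s i * w i b).
Proof.
under eq_bigr => x _ do rewrite prod_1D_subsets mulr_suml.
rewrite exchange_big /=; apply: eq_bigr => s _.
rewrite bigA_distr_bigA mulr_sumr; apply: eq_bigr => x _.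
by rewrite big_split prod_incident_degree /= -mulrA big_split.
Qed.

Lemma fpoly_vertex_sum (K : fieldType) (z : K) (n : nat) :
  z != 0 -> z + z^-1 != 0 ->
  (- z^-1) ^+ n * (z / (z + z^-1)) + z ^+ n * (z^-1 / (z + z^-1)) =
  (fpoly K n).[z - z^-1].
Proof.
move=> z0 zs0.
(* The recurrence has order two, so the induction carries two consecutive values. *)
suff: forall m, (- z^-1) ^+ m * (z / (z + z^-1)) + z ^+ m * (z^-1 / (z + z^-1))
    = (fpoly K m).[z - z^-1] /\
  (- z^-1) ^+ m.+1 * (z / (z + z^-1)) + z ^+ m.+1 * (z^-1 / (z + z^-1))
    = (fpoly K m.+1).[z - z^-1] by move=> /(_ n) [].
elim=> [|m [IH1 IH2]].
  rewrite /= !expr0 !expr1 !mul1r -mulrDl divff // hornerC horner0; split=> //.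
  (* For exponent 1 both terms equal [(z + z^-1)^-1] up to opposite signs and cancel, matching $f_1
     = 0$. *)
  by rewrite !mulrA mulNr mulVf // divff // mulNr addNr.
split=> //.
have root_rec (t c : K) : t ^+ 2 = (z - z^-1) * t + 1 ->
    t ^+ m.+2 * c = (z - z^-1) * (t ^+ m.+1 * c) + t ^+ m * c.
  by move=> t2; rewrite -[m.+2]addn2 exprD t2 exprS; ring.
rewrite [fpoly K m.+2]/= -/(fpoly K m.+1) hornerD hornerM hornerX -IH1 -IH2.
rewrite !root_rec; first by ring.
  by rewrite mulrN mulrBl mulfV //; ring.
by rewrite mulrBl mulVf //; ring.
Qed.

Theorem theorem1 (R : realType) (N : nat) (E : {set {set 'I_N}})
    (E_simple : simple_graph E) (E_connected : connected_graph E)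
    (xi : 'I_N -> R[i]) (beta : {set 'I_N} -> R[i])
    (xi_neq0 : forall i : 'I_N, xi i != 0)
    (xi_sum_neq0 : forall i : 'I_N, xi i + (xi i)^-1 != 0) :
  \sum_(x : {ffun 'I_N -> bool})
     ((\prod_(i < N) \prod_(j < N | (i < j)%N && ([set i; j] \in E))
         (1 + (spin (x i))%:~R * (spin (x j))%:~R * beta [set i; j]
              * xi i ^ (- spin (x i)) * xi j ^ (- spin (x j))))
      * \prod_(i < N) (xi i ^ spin (x i) / (xi i + (xi i)^-1)))
  = \sum_(s : {set {set 'I_N}} | s \subset E)
     ((\prod_(e in s) beta e)
      * \prod_(i < N) (fpoly R[i] (degree_in s i)).[xi i - (xi i)^-1]).
Proof.
pose t i b : R[i] := - ((spin b)%:~R * xi i ^ (- spin b)).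
pose w i b : R[i] := xi i ^ spin b / (xi i + (xi i)^-1).
transitivity (\sum_(x : {ffun 'I_N -> bool})
     (\prod_(e in E) (1 + beta e * \prod_(i in e) t i (x i))
      * \prod_i w i (x i))).
  apply: eq_bigr => x _; congr (_ * _); rewrite -prod_edges_ord //.
  apply: eq_bigr => i _; apply: eq_bigr => j /andP[lt_ij _].
  (* Since [i < j] the endpoints differ, so the product over the edge has exactly two factors, whose
     minus signs cancel. *)
  rewrite big_setU1 ?inE ?big_set1 /=; last by rewrite -val_eqE ltn_eqF.
  by rewrite /t; ring.
rewrite sum_spins_edge_expansion; apply: eq_bigr => s _; congr (_ * _).
(* Spin [true] gives the root [- (xi i)^-1] with weight numerator [xi i]; spin [false] gives the
   root [xi i] with numerator [(xi i)^-1]. *)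
apply: eq_bigr => i _; rewrite big_bool -fpoly_vertex_sum // /t /w /spin.
by rewrite opprK mulrN1z mul1r mulN1r opprK !exprN1 !expr1z.
Qed.
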